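(* $\delta(12\text{-}3)=\delta(21\text{-}3)=1$.
   Context: $[k]=\{1,\dots,k\}$ and $[k]^n$ is the set of words of length $n$ over $[k]$. $12\text{-}3$ and $21\text{-}3$ are generalized patterns of length $m=3$ with $b=2$ blocks. An occurrence of $12\text{-}3$ in a word $\sigma=\sigma_1\cdots\sigma_n$ is a subsequence $\sigma_i\sigma_{i+1}\sigma_j$ with $j>i+1$ and $\sigma_i<\sigma_{i+1}<\sigma_j$; an occurrence of $21\text{-}3$ is a subsequence $\sigma_i\sigma_{i+1}\sigma_j$ with $j>i+1$ and $\sigma_{i+1}<\sigma_i<\sigma_j$. $\nu(\pi,\sigma)$ is the number of occurrences of $\pi$ in $\sigma$. For $n\ge m$, $\delta(\pi,k,n)=\max\{\nu(\pi,\sigma):\sigma\in[k]^n\}/\binom{n-m+b}{b}$, which here has denominator $\binom{n-1}{2}$. The packing density is $\delta(\pi)=\lim_{n\to\infty}\lim_{k\to\infty}\delta(\pi,k,n)=\lim_{n\to\infty}\delta(\pi,n,n)$ (for $k\ge n$, $\delta(\pi,k,n)=\delta(\pi,n,n)$). *)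

(* Defs.v *)
From HB Require Import structures.
From mathcomp Require Import all_boot all_order all_algebra.
From mathcomp Require Import all_classical all_reals all_analysis.

Set Implicit Arguments.
Unset Strict Implicit.
Unset Printing Implicit Defensive.
Import Order.TTheory GRing.Theory Num.Theory.
Import numFieldNormedType.Exports.

Local Open Scope classical_set_scope.
Local Open Scope ring_scope.

(* A generalized pattern is given by its sequence of blocks: the dashes of the
   usual notation separate the blocks, so 12-3 is [:: [:: 1; 2]; [:: 3]]. *)
Definition gpattern := seq (seq nat).

Definition pattern_word (p : gpattern) : seq nat := flatten p.

Definition pattern_length (p : gpattern) : nat := size (pattern_word p).

Definition block_count (p : gpattern) : nat := size p.

Definition same_block (p : gpattern) (a c : nat) : bool :=
  reshape_index (shape p) a == reshape_index (shape p) c.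

(* Words over [k] = {1, ..., k} are tuples over 'I_k; letters are only ever
   compared with each other, so the shift by one is immaterial.  An occurrence
   is identified with the increasing list t of the positions it uses. *)
Definition occurrence (p : gpattern) (k n : nat) (s : n.-tuple 'I_k)
    (t : {ffun 'I_(pattern_length p) -> 'I_n}) : bool :=
  [&& [forall a : 'I_(pattern_length p), forall c : 'I_(pattern_length p),
         (a < c)%N ==> (t a < t c)%N],
      [forall a : 'I_(pattern_length p), forall c : 'I_(pattern_length p),
         ((c == a.+1 :> nat) && same_block p a c) ==> (t c == (t a).+1 :> nat)]
    & [forall a : 'I_(pattern_length p), forall c : 'I_(pattern_length p),
         (tnth s (t a) < tnth s (t c))%N
         == (nth 0%N (pattern_word p) a < nth 0%N (pattern_word p) c)%N]].

Definition nu (p : gpattern) (k n : nat) (s : n.-tuple 'I_k) : nat :=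
  #|[pred t : {ffun 'I_(pattern_length p) -> 'I_n} | occurrence s t]|.

(* Meaningful only for n >= pattern_length p, where n - m is not truncated. *)
Definition delta (R : realType) (p : gpattern) (k n : nat) : R :=
  (\max_(s : n.-tuple 'I_k) nu p s)%:R
  / 'C(n - pattern_length p + block_count p, block_count p)%:R.

(* Since [lim] is a total operator, existence of the inner limits is required
   explicitly. *)
Definition is_packing_density (R : realType) (p : gpattern) (l : R) : Prop :=
  (forall n, (pattern_length p <= n)%N ->
     cvg (delta R p k n @[k --> \oo])) /\
  lim (delta R p k n @[k --> \oo]) @[n --> \oo] --> l.

Definition p12_3 : gpattern := [:: [:: 1%N; 2%N]; [:: 3%N]].
Definition p21_3 : gpattern := [:: [:: 2%N; 1%N]; [:: 3%N]].

(* Main.v *)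
Require Import Defs.
From HB Require Import structures.
From mathcomp Require Import all_boot all_order all_algebra.
From mathcomp Require Import all_classical all_reals all_analysis.
From mathcomp Require Import zify lra.
Import Order.TTheory GRing.Theory Num.Theory.
Import numFieldNormedType.Exports.

Local Open Scope ring_scope.

(** An occurrence of a pattern with blocks of sizes 2 and 1 uses positions
    i, i+1, j with i+1 < j, and is determined by the pair (i, j).  There are
    C(n-1, 2) such pairs, which is exactly the denominator of delta, so every
    delta is at most 1 ([nu_le]).

    Widening the alphabet keeps all occurrences, so delta is nondecreasing in k;
    being bounded, it converges, and its limit dominates delta for every single
    alphabet.  Hence it suffices to exhibit, for each e > 0 and each large n,
    one word over some alphabet in which a proportion 1 - e of the pairs (i, j)
    are occurrences ([packing_density_eq1]).

    For 12-3 the increasing word 1 2 ... n works with e = 0: every pair is an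
    occurrence.

    For 21-3 the positions are cut into layers of length L; the letters decrease
    inside a layer and increase from one layer to the next.  A pair (i, j) is an
    occurrence as soon as i and i+1 lie in one layer and j in a later one.  The
    pairs that fail this have either i and j in the same layer, at most n * L
    pairs, or i at the end of its layer, at most (n / L) * n pairs
    ([nu21_3_layered_ge]).  As C(n-1, 2) is at least n^2 / 8, the lost proportion
    is at most 8 L / n + 8 / L, which is small once L is large and n is large
    compared with L. *)

Set Implicit Arguments.
Unset Strict Implicit.
Unset Printing Implicit Defensive.

(** * The limit over the alphabet size *)

Lemma nu_widen (p : gpattern) (k k' n : nat) (lekk' : (k <= k')%N)
    (s : n.-tuple 'I_k) : nu p (map_tuple (widen_ord lekk') s) = nu p s.
Proof.
apply: eq_card => t; rewrite !inE /occurrence; congr [&& _, _ & _].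
by apply: eq_forallb => a; apply: eq_forallb => c; rewrite !tnth_map.
Qed.

Lemma delta_nondecreasing (R : realType) (p : gpattern) (n : nat) :
  nondecreasing_seq (fun k => delta R p k n).
Proof.
move=> k k' lekk'; rewrite /delta ler_wpM2r ?invr_ge0 ?ler0n// ler_nat.
apply/bigmax_leqP => s _; rewrite -(nu_widen p lekk').
exact: (leq_bigmax (map_tuple (widen_ord lekk') s)).
Qed.

(** The number of candidate position maps bounds nu uniformly in k, so
    monotone convergence applies to every pattern. *)
Lemma is_cvg_delta (R : realType) (p : gpattern) (n : nat) :
  cvgn (fun k => delta R p k n).
Proof.
apply: nondecreasing_is_cvgn; first exact: delta_nondecreasing.
exists (#|{: {ffun 'I_(pattern_length p) -> 'I_n}}|%:R
        / 'C(n - pattern_length p + block_count p, block_count p)%:R) => _ [k _ <-].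
rewrite /delta ler_wpM2r ?invr_ge0 ?ler0n// ler_nat.
by apply/bigmax_leqP => s _; apply: max_card.
Qed.

(** * Patterns with blocks of sizes 2 and 1 *)

Lemma card_nonadjacent (n : nat) :
  #|[set u : 'I_n * 'I_n | (u.1.+1 < u.2)%N]| = 'C(n.-1, 2).
Proof.
rewrite -sum1_card (eq_bigl (fun u : 'I_n * 'I_n => (u.1.+1 < u.2)%N)); last first.
  by move=> u; rewrite inE.
rewrite -(pair_big_dep xpredT (fun i j : 'I_n => (i.+1 < j)%N) (fun _ _ => 1%N)) /=.
rewrite (exchange_big_dep xpredT) //=.
rewrite (eq_bigr (fun j : 'I_n => j.-1)) => [|j _]; last first.
  rewrite sum1dep_card; case: j => [[|j] jn] /=.
    by apply: eq_card0 => i; rewrite inE.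
  rewrite -[RHS]card_ord.
  have inj : injective (widen_ord (ltnW (ltnW jn))).
    by move=> a b /(congr1 val) /= ab; apply: val_inj.
  rewrite -(card_imset 'I_j inj); apply: eq_card => i; rewrite !inE ltnS.
  apply/idP/imsetP => [ij|[a _ ->]]; last exact: (ltn_ord a).
  by exists (Ordinal ij) => //; apply: val_inj.
rewrite -(big_mkord xpredT predn); case: n => [|n]; first by rewrite big_nil.
by rewrite big_nat_recl //= add0n bin2_sum.
Qed.

Section BlocksTwoOne.
Variables x y z : nat.

Let p : gpattern := [:: [:: x; y]; [:: z]].
Let p0 : 'I_(pattern_length p) := @Ordinal 3 0 isT.
Let p1 : 'I_(pattern_length p) := @Ordinal 3 1 isT.
Let p2 : 'I_(pattern_length p) := @Ordinal 3 2 isT.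

(** The middle position is forced to follow the first one, so an occurrence is
    recovered from its first and last positions. *)
Lemma nu_le (k n : nat) (s : n.-tuple 'I_k) : (nu p s <= 'C(n.-1, 2))%N.
Proof.
rewrite -card_nonadjacent /nu.
pose f (t : {ffun 'I_(pattern_length p) -> 'I_n}) := (t p0, t p2).
have adj t : occurrence s t -> t p1 = (t p0).+1 :> nat.
  by case/and3P => _ /forallP/(_ p0)/forallP/(_ p1)/implyP/(_ isT)/eqP.
rewrite -(@card_in_imset _ _ f) => [|t u].
  apply/subset_leq_card/fintype.subsetP => _ /imsetP[t ot ->].
  rewrite inE /= -(adj _ ot); case/and3P: ot => + _ _.
  by move=> /forallP/(_ p1)/forallP/(_ p2)/implyP; apply.
rewrite !inE => /adj t1 /adj u1 [t0 t2]; apply/ffunP => -[[|[|[|//]]] i3].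
- by rewrite (_ : Ordinal i3 = p0); [|apply: val_inj].
- rewrite (_ : Ordinal i3 = p1); [|apply: val_inj]; last by [].
  by apply: val_inj; rewrite /= t1 u1 t0.
- by rewrite (_ : Ordinal i3 = p2); [|apply: val_inj].
Qed.

(** Lower bounds on nu come from families P of pairs of positions that are
    easy to count; the letters are given by a function on all of nat so that
    position i+1 can be mentioned without a bound. *)
Lemma nu_ge (k n : nat) (s : n.-tuple 'I_k) (w : nat -> nat) (P : rel nat) :
  (forall i : 'I_n, tnth s i = w i :> nat) ->
  (forall i j a c, (i.+1 < j < n)%N -> P i j -> (a < 3)%N -> (c < 3)%N ->
     (nth 0%N [:: w i; w i.+1; w j] a < nth 0%N [:: w i; w i.+1; w j] c)%N
     = (nth 0%N [:: x; y; z] a < nth 0%N [:: x; y; z] c)%N) ->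
  (#|[set u : 'I_n * 'I_n | (u.1.+1 < u.2)%N && P u.1 u.2]| <= nu p s)%N.
Proof.
move=> sw wP.
(* The default value of insubd is arbitrary: i+1 < j < n puts i+1 in range. *)
pose f (u : 'I_n * 'I_n) : {ffun 'I_(pattern_length p) -> 'I_n} :=
  [ffun a : 'I_(pattern_length p) => nth u.1 [:: u.1; insubd u.1 u.1.+1; u.2] a].
have fE (u : 'I_n * 'I_n) (a : nat) : (u.1.+1 < u.2)%N -> (a < 3)%N ->
    nth u.1 [:: u.1; insubd u.1 u.1.+1; u.2] a
    = nth 0%N [:: val u.1; u.1.+1; val u.2] a :> nat.
  move=> u12; case: a => [|[|[|//]]] //= _.
  by rewrite val_insubd (ltn_trans u12).
rewrite -(@card_in_imset _ _ f) => [|u v _ _ /ffunP fuv]; last first.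
  have := fuv p0; have := fuv p2; rewrite !ffunE /=.
  by case: u v {fuv} => [u1 u2] [v1 v2] /= -> ->.
apply/subset_leq_card/fintype.subsetP => _ /imsetP[u + ->].
rewrite !inE => /andP[u12 Pu]; rewrite /occurrence.
apply/and3P; split; apply/forallP => a; apply/forallP => c;
  rewrite ?sw !ffunE !fE ?ltn_ord//.
- apply/implyP; case: a c => [[|[|[|//]]] a3] [[|[|[|//]]] c3] //=.
  by rewrite (ltn_trans _ u12).
- by apply/implyP; case: a c => [[|[|[|//]]] a3] [[|[|[|//]]] c3].
- have := wP u.1 u.2 a c; rewrite u12 ltn_ord => /(_ isT Pu (ltn_ord a) (ltn_ord c)) <-.
  by case: a c => [[|[|[|//]]] a3] [[|[|[|//]]] c3].
Qed.

(** By [nu_le] and monotonicity in k, the inner limit lies between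
    delta R p k n, for any k, and 1; the alphabet of the witness may therefore
    depend on n and on e. *)
Lemma packing_density_eq1 (R : realType) :
  (forall e : R, 0 < e -> \forall n \near eventually, exists k (s : n.-tuple 'I_k),
     (1 - e) * 'C(n.-1, 2)%:R <= (nu p s)%:R) ->
  is_packing_density p (1 : R).
Proof.
move=> nuP; split=> [n _|]; first exact: is_cvg_delta.
apply/cvgrPdist_le => e e0.
near=> n.
have n3 : (3 <= n)%N by near: n; exact: nbhs_infty_ge.
have [k [s ns]] : exists k (s : n.-tuple 'I_k),
     (1 - e) * 'C(n.-1, 2)%:R <= (nu p s)%:R :> R by near: n; exact: nuP.
have C0 : 0 < 'C(n.-1, 2)%:R :> R by rewrite ltr0n bin_gt0; lia.
have dE m : delta R p m n
    = (\max_(s : n.-tuple 'I_m) nu p s)%:R / 'C(n.-1, 2)%:R.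
  rewrite /delta (_ : n - pattern_length p + block_count p = n.-1)%N //.
  by rewrite /pattern_length /block_count /=; lia.
have le1 : limn (fun k => delta R p k n) <= 1.
  apply: limr_le; first exact: is_cvg_delta.
  near=> m; rewrite dE ler_pdivrMr// mul1r ler_nat.
  by apply/bigmax_leqP => t _; exact: nu_le.
have gee : 1 - e <= limn (fun k => delta R p k n).
  have := nondecreasing_cvgn_le (@delta_nondecreasing R p n)
    (@is_cvg_delta R p n) k.
  apply: le_trans.
  rewrite dE ler_pdivlMr// (le_trans ns)// ler_nat.
  exact: (leq_bigmax s).
by rewrite ger0_norm ?subr_ge0// lerBlDr addrC -lerBlDr.
Unshelve. all: by end_near.
Qed.

End BlocksTwoOne.

(** * The increasing word for 12-3 *)

Lemma nu12_3_increasing (n : nat) :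
  ('C(n.-1, 2) <= nu p12_3 (ord_tuple n))%N.
Proof.
rewrite -card_nonadjacent.
have := @nu_ge 1 2 3 n n (ord_tuple n) id (fun _ _ => true).
under eq_finset => u do rewrite andbT.
apply=> [i|i j a c]; first by rewrite tnth_ord_tuple.
by case: a c => [|[|[|//]]] [|[|[|//]]] //= ? _ _ _; lia.
Qed.

(** * The layered word for 21-3 *)

(** Layer q consists of the positions q L, ..., q L + L - 1 and carries the
    letters q L + L, ..., q L + 1 in this order.  The last layer may be
    incomplete and then uses letters above n, whence the alphabet size n + L
    below. *)
Definition layered_letter (L i : nat) : nat := i %/ L * L + (L - i %% L).

Lemma layered_letter_lt (L n i : nat) :
  (i < n)%N -> (layered_letter L i < n + L)%N.
Proof. by rewrite /layered_letter => ltin; have := divn_eq i L; lia. Qed.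

Definition layered_word (L n : nat) : n.-tuple 'I_(n + L) :=
  [tuple Ordinal (layered_letter_lt L (ltn_ord i)) | i < n].

Definition layer_adjacent (L : nat) : rel nat :=
  fun i j => (i.+1 %/ L == i %/ L)%N && (i %/ L < j %/ L)%N.

Lemma layered_letter_descent (L i : nat) : (0 < L)%N ->
  (i.+1 %/ L = i %/ L)%N -> (layered_letter L i.+1 < layered_letter L i)%N.
Proof.
move=> L0 e; rewrite /layered_letter e.
have := divn_eq i L; have := divn_eq i.+1 L; rewrite e.
by have := ltn_pmod i.+1 L0; lia.
Qed.

Lemma layered_letter_ascent (L i j : nat) : (0 < L)%N ->
  (i %/ L < j %/ L)%N -> (layered_letter L i < layered_letter L j)%N.
Proof.
move=> L0 ij; rewrite /layered_letter.
have := leq_mul ij (leqnn L); rewrite mulSn.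
by have := ltn_pmod j L0; lia.
Qed.

Lemma nu21_3_layered_ge_card (L n : nat) : (0 < L)%N ->
  (#|[set u : 'I_n * 'I_n | (u.1.+1 < u.2)%N && layer_adjacent L u.1 u.2]|
   <= nu p21_3 (layered_word L n))%N.
Proof.
move=> L0; apply: (@nu_ge 2 1 3 _ _ _ (layered_letter L)) => [i|i j a c _].
  by rewrite tnth_mktuple.
move=> /andP[/eqP ee lt].
have := layered_letter_descent L0 ee.
have := layered_letter_ascent L0 lt.
by case: a c => [|[|[|//]]] [|[|[|//]]] //= ? ? _ _; lia.
Qed.

(** Given i, an element j of its layer is determined by its residue modulo L. *)
Lemma card_same_layer (L n : nat) : (0 < L)%N ->
  (#|[set u : 'I_n * 'I_n | (u.1 %/ L == u.2 %/ L)%N]| <= n * L)%N.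
Proof.
case: L => // L _.
pose f (u : 'I_n * 'I_n) := (u.1, inord (u.2 %% L.+1) : 'I_L.+1).
rewrite [leqRHS](_ : _ = #|{: 'I_n * 'I_L.+1}|); last by rewrite card_prod !card_ord.
rewrite -(@card_in_imset _ _ f) ?max_card// => -[u1 u2] [v1 v2].
rewrite !inE /= => /eqP eu /eqP ev [e1 /(congr1 val)]; rewrite /= !inordK ?ltn_pmod// => e2.
congr (_, _); first exact: e1.
by apply: val_inj; rewrite /= (divn_eq u2 L.+1) (divn_eq v2 L.+1) e2 -eu -ev e1.
Qed.

(** A layer that has an end before n is complete, hence one of the first n / L
    layers, and it determines its end. *)
Lemma card_layer_end (L n : nat) : (0 < L)%N ->
  (#|[set u : 'I_n * 'I_n | (u.1.+1 %/ L != u.1 %/ L)%N]| <= n %/ L * n)%N.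
Proof.
move=> L0.
have lastE i : (i.+1 %/ L != i %/ L)%N -> (i = i %/ L * L + L.-1)%N.
  have := divn_eq i L; have := ltn_pmod i L0.
  case: (ltnP (i %% L).+1 L) => [lt _ iE|ge lt iE _]; last by lia.
  by rewrite {1}iE -addnS divnMDl// (divn_small lt) addn0 eqxx.
have qlt (i : 'I_n) : (i.+1 %/ L != i %/ L)%N -> (i %/ L < n %/ L)%N.
  by move=> /lastE iE; rewrite leq_divRL// mulSn; have := ltn_ord i; lia.
(* A member of the set provides the default value needed to map into the
   possibly empty type 'I_(n %/ L). *)
case: (set_0Vmem [set u : 'I_n * 'I_n | (u.1.+1 %/ L != u.1 %/ L)%N]) => [->|[u0]].
  by rewrite cards0.
rewrite inE => /qlt u0q; pose q0 := Ordinal u0q.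
pose f (u : 'I_n * 'I_n) := (insubd q0 (u.1 %/ L)%N, u.2).
rewrite [leqRHS](_ : _ = #|{: 'I_(n %/ L) * 'I_n}|); last by rewrite card_prod !card_ord.
rewrite -(@card_in_imset _ _ f) ?max_card// => -[u1 u2] [v1 v2].
rewrite !inE /= => eu ev [/(congr1 val) + e2].
rewrite /= !val_insubd !qlt// => e1; congr (_, _); last exact: e2.
by apply: val_inj; rewrite /= (lastE _ eu) (lastE _ ev) e1.
Qed.

Lemma nu21_3_layered_ge (L n : nat) : (0 < L)%N ->
  ('C(n.-1, 2) <= nu p21_3 (layered_word L n) + (n * L + n %/ L * n))%N.
Proof.
move=> L0; rewrite -card_nonadjacent.
apply: leq_trans (leq_add (nu21_3_layered_ge_card n L0)
  (leq_add (card_same_layer n L0) (card_layer_end n L0))).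
rewrite addnA; apply: leq_trans (leq_add (leq_card_setU _ _) (leqnn _)).
apply: leq_trans (leq_card_setU _ _).
apply/subset_leq_card/fintype.subsetP => u; rewrite !inE /layer_adjacent => u12.
have := leq_div2r L (ltnW (ltnW u12)); rewrite u12 leq_eqVlt => /orP[->|->].
  by rewrite ?orbT.
by case: eqP; rewrite ?orbT.
Qed.

(** A quadratic lower bound on the denominator is all that the comparison with
    the error terms needs; the constant 8 makes it hold from n = 4 on. *)
Lemma sqr_le_bin (n : nat) : (4 <= n)%N -> (n * n <= 8 * 'C(n.-1, 2))%N.
Proof.
case: n => [|[|n]]// n4; rewrite bin2 /=.
have := odd_double_half (n.+1 * n); rewrite oddM /= andNb add0n -muln2.
by nia.
Qed.

Lemma nu21_3_layered_asymp (R : realType) (e : R) : 0 < e ->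
  \forall n \near eventually, exists k (s : n.-tuple 'I_k),
     (1 - e) * 'C(n.-1, 2)%:R <= (nu p21_3 s)%:R.
Proof.
move=> e0.
(* For n >= L^2 each error term is at most n^2 / L, hence the two together are
   at most 2 n^2 / L <= 16 C(n-1, 2) / L. *)
pose L := (Num.truncn (16 / e)).+1.
have Le : 16 <= e * L%:R.
  by rewrite mulrC -ler_pdivrMr//; apply/ltW/truncnS_gt.
near=> n.
have nL : (L * L + 4 <= n)%N by near: n; exact: nbhs_infty_ge.
exists (n + L)%N, (layered_word L n).
have n4 : (4 <= n)%N by lia.
have LLn : (L * L <= n)%N by lia.
have := nu21_3_layered_ge n (ltn0Sn _ : (0 < L)%N).
have : (L * (n * L + n %/ L * n) <= 2 * (n * n))%N.
  by have := leq_divM n L; nia.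
have := sqr_le_bin n4.
rewrite -!(ler_nat R) !(natrD, natrM).
set C := 'C(_, _)%:R; set V := (nu _ _)%:R.
set B := (_ * _ + _ : R).
move=> nC LB CV.
have L0 : 0 < L%:R :> R by rewrite ltr0n.
have C0 : 0 <= C by exact: ler0n.
suff : B <= e * C by lra.
rewrite -(ler_pM2l L0) (le_trans LB)//.
have := ler_wpM2r C0 Le; lra.
Unshelve. all: by end_near.
Qed.

Unset Implicit Arguments.

Theorem proposition3p7 (R : realType) :
  is_packing_density p12_3 (1 : R) /\ is_packing_density p21_3 (1 : R).
Proof.
split; apply: packing_density_eq1 => e e0; last exact: nu21_3_layered_asymp.
near=> n; exists n, (ord_tuple n).
apply: (@le_trans _ _ 'C(n.-1, 2)%:R); last by rewrite ler_nat nu12_3_increasing.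
by rewrite ler_piMl ?ler0n// gerBl ltW.
Unshelve. all: by end_near.
Qed.
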